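(* Let $A\in\mathbb{S}\subset\mathbb{C}^{n\times n}$. Suppose $\{(\lambda^c_i,X^c_{i,l})\}_{l=1}^{m_i}$, $\{(\epsilon_2\overline{\lambda^c_i},\tilde{X}^c_{i,l})\}_{l=1}^{m_i}$ ($i=1,\dots,q$) and $\{(\lambda^c_j,X^c_{j,l})\}_{l=1}^{m_j}$ ($j=2q+1,\dots,p$) are the complete collections of Jordan pairs of $A$ for the eigenvalues $\lambda_i^c$, $\epsilon_2\overline{\lambda_i^c}$, $\lambda_j^c$ respectively, where $\lambda^c_i\neq\epsilon_2\overline{\lambda^c_i}$, $\lambda_j^c=\epsilon_2\overline{\lambda_j^c}$, $\#(\tilde X^c_{i,l})=\#(X^c_{i,l})$, and all the numbers $\lambda_i^c,\epsilon_2\overline{\lambda_i^c},\lambda_j^c$ are pairwise distinct. Let $\lambda^a_i,\lambda^a_j$ be a collection of scalars with $\lambda^a_i\neq\epsilon_2\overline{\lambda^a_i}$ for $i=1,\dots,q$ and $\lambda^a_j=\epsilon_2\overline{\lambda^a_j}$ for $j=2q+1,\dots,p$. Put $$X_c=\begin{bmatrix}X_1^c&\cdots&X_q^c&X_{2q+1}^c&\cdots&X_p^c\end{bmatrix},\quad X_i^c=\begin{bmatrix}\hat{X}_i^c&\tilde{X}_i^c\end{bmatrix},$$ $\hat{X}_i^c=[X^c_{i,1}\ \cdots\ X^c_{i,m_i}]$, $\tilde{X}_i^c=[\tilde{X}^c_{i,1}\ \cdots\ \tilde{X}^c_{i,m_i}]$, $X^c_j=[X^c_{j,1}\ \cdots\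 X^c_{j,m_j}]$, and for $s\in\{c,a\}$ $$\Lambda_s=\mathrm{diag}(\Lambda_1^s,\dots,\Lambda_q^s,\Lambda_{2q+1}^s,\dots,\Lambda_p^s),\quad\Lambda_i^s=\mathrm{diag}(\hat{\Lambda}_i^s,\tilde{\Lambda}_i^s),$$ $\hat{\Lambda}_i^s=\mathrm{diag}(J_1(\lambda_i^s),\dots,J_{m_i}(\lambda_i^s))$, $\tilde{\Lambda}_i^s=\mathrm{diag}(J_1(\epsilon_2\overline{\lambda_i^s}),\dots,J_{m_i}(\epsilon_2\overline{\lambda_i^s}))$, $\Lambda_j^s=\mathrm{diag}(J_1(\lambda_j^s),\dots,J_{m_j}(\lambda_j^s))$, where $J_l(\lambda_i^s)$ and $J_l(\epsilon_2\overline{\lambda_i^s})$ have size $\#(X_{i,l}^c)$ and $J_l(\lambda_j^s)$ has size $\#(X_{j,l}^c)$ for both $s=c$ and $s=a$. (i) Any structured perturbation $\Delta A\in\mathbb{S}$ of $A$ for which $\{(\lambda^a_i,X^c_{i,l})\}_{l=1}^{m_i}$, $\{(\epsilon_2\overline{\lambda^a_i},\tilde{X}^c_{i,l})\}_{l=1}^{m_i}$, $\{(\lambda^a_j,X^c_{j,l})\}_{l=1}^{m_j}$ ($i=1,\dots,q$, $j=2q+1,\dots,p$) are Jordan pairs of $A+\Delta A$ is given by $$\Delta A=X_c(\Lambda_a-\Lambda_c)X_c^{\dagger}+\epsilon_2H^{-1}(X_c^\dagger)^*(\Lambda_a-\Lambda_c)^*X_c^*H-H^{-1}(X_c^{\dagger})^*X_c^*HX_c(\Lambda_a-\Lambda_c)X_c^{\dagger}+H^{-1}(I-X_cX_c^{\dagger})Z(I-X_cX_c^{\dagger}),$$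 where $Z\in\mathbb{C}^{n\times n}$ with $Z^*=\epsilon_1\epsilon_2Z$ is arbitrary. (ii) Let $r=\sum_{i=1}^q2\alpha(\lambda_i^c)+\sum_{j=2q+1}^p\alpha(\lambda_j^c)$ and let $\lambda_k^f$, $k=r+1,\dots,n$, be the rest of the eigenvalues of $A$. If $$\{\lambda^c_i,\epsilon_2\overline{\lambda^c_i},\lambda^c_j:i=1,\dots,q,\ j=2q+1,\dots,p\}\cap\{\lambda_k^f:k=r+1,\dots,n\}=\emptyset,$$ then a no spillover structured perturbation of rank $r$ is given by $$\Delta A=X_c(\Lambda_a-\Lambda_c)(X_c^*HX_c)^{-1}X_c^*H.$$
   Context: $*$ is the conjugate transpose. $H\in\mathbb{C}^{n\times n}$ is a fixed unitary matrix with $H^*=\epsilon_1H$, $\epsilon_1\in\{1,-1\}$. For $A\in\mathbb{C}^{n\times n}$ put $A^{[*]}=H^{-1}A^*H$; $\mathbb{L}=\{A:A^{[*]}=-A\}$, $\mathbb{J}=\{A:A^{[*]}=A\}$; $\mathbb{S}\in\{\mathbb{L},\mathbb{J}\}$, with $\epsilon_2=1$ if $\mathbb{S}=\mathbb{J}$ and $\epsilon_2=-1$ if $\mathbb{S}=\mathbb{L}$. $X^\dagger$ is the Moore-Penrose pseudoinverse; $\alpha(\lambda)$ is the algebraic multiplicity of the eigenvalue $\lambda$ of $A$. $J_l(\mu)$ denotes the upper triangular Jordan block with eigenvalue $\mu$ of the indicated size. A Jordan pair of $A$ is a pair $(\lambda,X)$ where $\lambda$ is an eigenvalue of $A$ and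 the columns of $X$ are the (linearly independent) vectors of a Jordan chain for $\lambda$, ordered so that $AX=XJ(\lambda)$ with $J(\lambda)$ the Jordan block of size $\#(X)$, the number of columns of $X$. A complete collection $\{(\lambda,X_l)\}_{l=1}^m$ of Jordan pairs for an eigenvalue $\lambda$ of geometric multiplicity $m$ means that the columns of $X_1,\dots,X_m$ together form a basis of the generalized eigenspace of $\lambda$ (so $\alpha(\lambda)=\sum_l\#(X_l)$). A no spillover structured perturbation is a $\Delta A\in\mathbb{S}$ such that $(A+\Delta A)X_c=X_c\Lambda_a$ and $A+\Delta A$ preserves the Jordan pairs of $A$ belonging to the remaining eigenvalues $\lambda_k^f$, i.e. $(A+\Delta A)X=XJ(\lambda_k^f)$ whenever $(\lambda_k^f,X)$ is a Jordan pair of $A$; these remaining Jordan pairs need not be known.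
   Formalization: In (ii), rank exactly r is claimed only when every λ^a_i ≠ λ^c_i and λ^a_j ≠ λ^c_j (otherwise the rank is smaller, e.g. ΔA = 0 when Λ_a = Λ_c); in general only rank ≤ r is stated. *)

(* Defs.v *)
From mathcomp Require Import all_boot all_order all_algebra.

Set Implicit Arguments.
Unset Strict Implicit.
Unset Printing Implicit Defensive.

Import Order.TTheory GRing.Theory Num.Theory.
Local Open Scope ring_scope.
Local Open Scope sesquilinear_scope.

Section MoorePenrose.
Variable C : numClosedFieldType.

Definition penrose m n (X : 'M[C]_(m, n)) (Y : 'M[C]_(n, m)) : bool :=
  [&& X *m Y *m X == X, Y *m X *m Y == Y,
      (X *m Y)^t* == X *m Y & (Y *m X)^t* == Y *m X].

Lemma adjM m n p (A : 'M[C]_(m, n)) (B : 'M[C]_(n, p)) :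
  (A *m B)^t* = B^t* *m A^t*.
Proof. by rewrite trmx_mul map_mxM. Qed.

Lemma mulmx_adj_eq0 m n (B : 'M[C]_(m, n)) : B *m B^t* = 0 -> B = 0.
Proof.
move=> B0; apply/matrixP => i j; rewrite mxE; apply/eqP.
have /eqP: (B *m B^t*) i i = 0 by rewrite B0 mxE.
rewrite mxE psumr_eq0 => [|k _]; last by rewrite !mxE mul_conjC_ge0.
by move=> /allP /(_ j (mem_index_enum _)); rewrite !mxE mul_conjC_eq0.
Qed.

Lemma gram_unit m n (R : 'M[C]_(m, n)) : row_free R -> R *m R^t* \in unitmx.
Proof.
move=> fR; rewrite -row_free_unit -kermx_eq0; apply/eqP.
set K := kermx _; suff KR : K *m R = 0.
  by apply: (row_free_inj fR); rewrite KR mul0mx.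
apply: mulmx_adj_eq0.
by rewrite adjM !mulmxA -(mulmxA K) mulmx_ker mul0mx.
Qed.

Lemma invmx_herm n (G : 'M[C]_n) : G^t* = G -> (invmx G)^t* = invmx G.
Proof. by move=> GG; rewrite trmx_inv map_invmx GG. Qed.

Lemma penrose_exists m n (X : 'M[C]_(m, n)) : exists Y, penrose X Y.
Proof.
have [r [F [R [fF fR ->]]]] : exists r (F : 'M_(m, r)) (R : 'M_(r, n)),
    [/\ row_free (F^t*), row_free R & X = F *m R].
  exists (\rank X), (col_base X), (row_base X); split.
  - by rewrite /row_free mxrank_map mxrank_tr -/(row_full _) col_base_full.
  - exact: row_base_free.
  - by rewrite mulmx_base.
have := gram_unit fF; rewrite trmxCK => uF; have uR := gram_unit fR.
set GF := F^t* *m F in uF; set GR := R *m R^t* in uR.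
have hF : (invmx GF)^t* = invmx GF.
  by apply: invmx_herm; rewrite /GF adjM trmxCK.
have hR : (invmx GR)^t* = invmx GR.
  by apply: invmx_herm; rewrite /GR adjM trmxCK.
pose Y := R^t* *m invmx GR *m invmx GF *m F^t*.
have XY : F *m R *m Y = F *m invmx GF *m F^t*.
  by rewrite /Y !mulmxA -(mulmxA F) -/GR mulmxK.
have YX : Y *m (F *m R) = R^t* *m invmx GR *m R.
  by rewrite /Y !mulmxA -(mulmxA _ (F^t*)) -/GF mulmxKV.
exists Y; apply/and4P; split; apply/eqP.
- by rewrite XY !mulmxA -(mulmxA _ (F^t*)) -/GF mulmxKV.
- by rewrite YX /Y !mulmxA -(mulmxA _ R) -/GR mulmxKV.
- by rewrite XY !adjM trmxCK hF mulmxA.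
- by rewrite YX !adjM trmxCK hR mulmxA.
Qed.

Lemma penrose_uniq m n (X : 'M[C]_(m, n)) Y Z :
  penrose X Y -> penrose X Z -> Y = Z.
Proof.
move=> /and4P[/eqP Y1 /eqP Y2 /eqP Y3 /eqP Y4].
move=> /and4P[/eqP Z1 /eqP Z2 /eqP Z3 /eqP Z4].
have e1 : X *m Y = X *m Z.
  by rewrite -[in LHS]Z1 -mulmxA -[in LHS]Z3 -Y3 -adjM mulmxA Y1.
have e2 : Y *m X = Z *m X.
  rewrite -[in LHS]Z1 -mulmxA mulmxA -[in LHS]Y4 -[in LHS]Z4 -adjM.
  by rewrite -mulmxA (mulmxA X) Y1.
by rewrite -Y2 -mulmxA e1 mulmxA e2 Z2.
Qed.

Definition mpinv m n (X : 'M[C]_(m, n)) : 'M[C]_(n, m) :=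
  xchoose (penrose_exists X).

Lemma mpinvP m n (X : 'M[C]_(m, n)) : penrose X (mpinv X).
Proof. exact: xchooseP. Qed.

End MoorePenrose.

Section Structured.
Variable C : numClosedFieldType.

(* the Lie algebra {A : A^[*] = - A} and the Jordan algebra {A : A^[*] = A},
   where A^[*] is [sadj H A] *)
Variant sclass := LieAlg | JordanAlg.

Definition eps2 (S : sclass) : C := if S is JordanAlg then 1 else -1.

Definition sadj n (H A : 'M[C]_n) : 'M[C]_n := invmx H *m A^t* *m H.

Definition in_class n (S : sclass) (H A : 'M[C]_n) : Prop :=
  match S with
  | LieAlg => sadj H A = - A
  | JordanAlg => sadj H A = A
  end.

Definition jordan_block d (mu : C) : 'M[C]_d :=
  \matrix_(i < d, j < d)
    (if i == j then mu else if j == i.+1 :> nat then 1 else 0).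

(* [eigenvalue], [eigenspace] and [geigenspace] speak of row vectors acted on
   from the right; Jordan chains consist of column vectors, whence [A^T] below *)
Definition jordan_pair n (A : 'M[C]_n) d (lam : C) (X : 'M[C]_(n, d)) : Prop :=
  [/\ (0 < d)%N, eigenvalue A^T lam, row_free X^T
    & A *m X = X *m jordan_block d lam].

Definition complete_collection n (A : 'M[C]_n) (lam : C) m (d : 'I_m -> nat)
    (X : forall l, 'M[C]_(n, d l)) : Prop :=
  [/\ eigenvalue A^T lam, m = \rank (eigenspace A^T lam),
      forall l, jordan_pair A lam (X l),
      row_free (\mxrow_(l < m) X l)^T
    & ((\mxrow_(l < m) X l)^T == geigenspace A^T lam)%MS].

Definition alg_mult n (A : 'M[C]_n) (lam : C) : nat := mup lam (char_poly A).

(* The pairs (lam_i, eps2 conj(lam_i)) are indexed by ['I_q], the eigenvalues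
   fixed by z |-> eps2 conj(z) by ['I_s]; [mp] and [dp] (resp. [ms] and [ds])
   give the number and the sizes of the corresponding Jordan blocks. *)
Section Blocks.
Variables (n q s : nat).
Variables (mp : 'I_q -> nat) (dp : forall i, 'I_(mp i) -> nat).
Variables (ms : 'I_s -> nat) (ds : forall j, 'I_(ms j) -> nat).

Definition pair_size (i : 'I_q) : nat :=
  (\sum_(l < mp i) dp l + \sum_(l < mp i) dp l)%N.
Definition self_size (j : 'I_s) : nat := (\sum_(l < ms j) ds l)%N.
Definition total_size : nat :=
  (\sum_(i < q) pair_size i + \sum_(j < s) self_size j)%N.

Definition chain_mx (X Xt : forall i (l : 'I_(mp i)), 'M[C]_(n, dp l))
    (Xs : forall j (l : 'I_(ms j)), 'M[C]_(n, ds l)) : 'M[C]_(n, total_size) :=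
  row_mx
    (\mxrow_(i < q)
       (row_mx (\mxrow_(l < mp i) X i l) (\mxrow_(l < mp i) Xt i l)
          : 'M[C]_(n, pair_size i)))
    (\mxrow_(j < s) (\mxrow_(l < ms j) Xs j l : 'M[C]_(n, self_size j))).

Definition jordan_mx (S : sclass) (lam : 'I_q -> C) (lams : 'I_s -> C) :
    'M[C]_total_size :=
  block_mx
    (\mxdiag_(i < q)
       (block_mx
          (\mxdiag_(l < mp i) jordan_block (dp l) (lam i)) 0
          0 (\mxdiag_(l < mp i) jordan_block (dp l) (eps2 S * (lam i)^*))
          : 'M[C]_(pair_size i)))
    0 0
    (\mxdiag_(j < s)
       (\mxdiag_(l < ms j) jordan_block (ds l) (lams j)
          : 'M[C]_(self_size j))).
End Blocks.

Definition eig_list q s (S : sclass) (lam : 'I_q -> C) (lams : 'I_s -> C) :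
    seq C :=
  [seq lam i | i : 'I_q] ++ [seq eps2 S * (lam i)^* | i : 'I_q]
    ++ [seq lams j | j : 'I_s].

Definition no_spillover n (S : sclass) (H A : 'M[C]_n)
    r (Xc : 'M[C]_(n, r)) (La : 'M[C]_r) k (lamf : 'I_k -> C)
    (dA : 'M[C]_n) : Prop :=
  [/\ in_class S H dA,
      (A + dA) *m Xc = Xc *m La
    & forall (t : 'I_k) d (X : 'M[C]_(n, d)), jordan_pair A (lamf t) X ->
        (A + dA) *m X = X *m jordan_block d (lamf t)].

End Structured.

Arguments eps2 {C} S.
Arguments alg_mult {C n} A lam.

(* Main.v *)
(* The difference D = Lambda_a - Lambda_c is diagonal and constant on each group
   of Jordan chains with a common eigenvalue.  If p(A) Z = 0 and x lies in the
   generalized eigenspace of A for lambda, then x^* H Z = 0 as soon as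
   eps2 conj(lambda) is not a root of p: both p(A) and a power of
   A - eps2 conj(lambda) annihilate, and the polynomials are coprime.  Hence the
   Gram matrix G = X_c^* H X_c only pairs lambda with eps2 conj(lambda), which
   gives D^* G = eps2 G D, the compatibility condition for the structured
   equation dA X_c = X_c D.
   (i) X_c has full column rank, and with K = H dA, P = X_c X_c^+ one has
   K = KP + PK - PKP + (I-P)K(I-P), where KP is prescribed, PK is determined by
   K^* = eps1 eps2 K, and the last summand is free.
   (ii) C^n is the sum of the span of X_c and of the kernel of the cofactor
   p(A), which is H-orthogonal to X_c; hence a vector X_c u with G u = 0 is
   H-orthogonal to everything, so G is invertible. *)
Require Import Defs.
From HB Require Import structures.
From mathcomp Require Import all_boot all_order all_algebra.
From mathcomp Require Import complex reals.

Set Implicit Arguments.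
Unset Strict Implicit.
Unset Printing Implicit Defensive.

Import Order.TTheory GRing.Theory Num.Theory.
Local Open Scope ring_scope.
Local Open Scope sesquilinear_scope.

(** * Generalized eigenspaces, invariant decompositions and algebraic multiplicities *)

Section GeneralizedEigenspaces.
Variable F : fieldType.

(** A Bezout identity for [p] and [q], evaluated at [A] and inserted between [U] and [V], leaves two
    terms, each killed on one side. *)
Lemma coprime_annihilators_mul0 n k l (A : 'M[F]_n.+1) (p q : {poly F})
    (U : 'M_(k, n.+1)) (V : 'M_(n.+1, l)) :
  coprimep p q -> U *m horner_mx A p = 0 -> horner_mx A q *m V = 0 ->
  U *m V = 0.
Proof.
move=> /Bezout_eq1_coprimepP[[u v] /= uv] Up qV.
have := congr1 (fun r => U *m horner_mx A r *m V) uv.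
rewrite rmorph1 mulmx1 => <-.
rewrite mulrC !rmorphD !rmorphM /= mulmxDr mulmxDl.
by rewrite !mulmxA Up !mul0mx add0r -mulmxA qV mulmx0.
Qed.

Lemma char_poly_tr n (A : 'M[F]_n) : char_poly A^T = char_poly A.
Proof.
rewrite /char_poly -[RHS]det_tr; congr (\det _).
by apply/matrixP=> i j; rewrite !mxE eq_sym.
Qed.

Lemma char_poly_block_diag k l (B : 'M[F]_k) (D : 'M[F]_l) :
  char_poly (block_mx B 0 0 D) = char_poly B * char_poly D.
Proof. by rewrite /char_poly char_block_diag_mx det_ublock. Qed.

Lemma char_poly_simmx n (A B P : 'M[F]_n) :
  P \in unitmx -> P *m A = B *m P -> char_poly A = char_poly B.
Proof.
move=> uP PA; have uP' : \det (map_mx (@polyC F) P) != 0.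
  by rewrite det_map_mx polyC_eq0 -unitfE -unitmxE.
apply: (mulfI uP'); rewrite -det_mulmx mulrC -det_mulmx; congr (\det _).
rewrite /char_poly_mx mulmxBr mulmxBl -!map_mxM PA; congr (_ - _).
by rewrite -scalar_mxC.
Qed.

(** The rows of [V] and [W] together form a basis in which [A] is block diagonal. *)
Lemma char_poly_direct n k l (A : 'M[F]_n) (V : 'M_(k, n)) (W : 'M_(l, n)) B D :
  (k + l = n)%N -> row_free (col_mx V W) -> V *m A = B *m V ->
  W *m A = D *m W -> char_poly A = char_poly B * char_poly D.
Proof.
move=> e; move: A V W; rewrite -{}e => A V W fVW VA WA.
rewrite -char_poly_block_diag; apply: (@char_poly_simmx _ _ _ (col_mx V W)).
  by rewrite -row_free_unit.
by rewrite mul_col_mx mul_block_col !mul0mx addr0 add0r VA WA.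
Qed.

(** An eigenvector of the restriction to [V], read in the whole space, lies in the kernels of both
    [A - b] and [p(A)]. If [b] were not a root of [p], coprimality would make these kernels meet
    only in 0. *)
Lemma root_char_poly_conjmx n k (A : 'M[F]_n) (V : 'M_(k, n)) p b :
  row_free V -> stablemx V A -> (V <= kermxpoly A p)%MS ->
  root (char_poly (conjmx V A)) b -> root p b.
Proof.
move=> fV sV Vp; rewrite -eigenvalue_root_char => /eigenvalueP[v vb v0].
apply: contra_neqT v0 => pb.
have vV : (v *m V <= kermxpoly A ('X - b%:P) :&: kermxpoly A p)%MS.
  rewrite sub_capmx (submx_trans (submxMl _ _) Vp) andbT -eigenspace_poly.
  by rewrite -sub_eigenspace_conjmx//; apply/eigenspaceP.
move: vV; rewrite mxdirect_kermxpoly ?submx0; last first.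
  by rewrite coprimep_sym coprimep_XsubC.
by rewrite mulmx_free_eq0// => /eqP.
Qed.

End GeneralizedEigenspaces.

Lemma closed_monic_single_root (F : closedFieldType) (p : {poly F}) a :
  p \is monic -> (forall b, root p b -> b = a) ->
  p = ('X - a%:P) ^+ (size p).-1.
Proof.
move=> /monicP pM; have [r] := closed_field_poly_normal p.
rewrite pM scale1r => -> ra.
have -> : r = nseq (size r) a.
  by apply/all_pred1P/allP => b br; apply/eqP/ra; rewrite root_prod_XsubC.
by rewrite size_prod_XsubC size_nseq big_nseq iter_mulr_1.
Qed.

(** Write the characteristic polynomial as [q * ('X - a)^m] with [q(a) != 0]. The space splits into
    the generalized eigenspace and the kernel of [q(A)]; the restriction to the latter does not have
    the eigenvalue [a], the restriction to the former has no other, so its characteristic polynomial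
    is a power of ['X - a] whose exponent is the rank. *)
Lemma rank_geigenspace (F : closedFieldType) n (A : 'M[F]_n) (a : F) :
  \rank (geigenspace A a) = mup a (char_poly A).
Proof.
case: n => [|n] in A *.
  by rewrite flatmx0 mxrank0 mupNroot// /char_poly det_mx00 root1.
have [m [q]] := multiplicity_XsubC (char_poly A) a.
rewrite monic_neq0 ?char_poly_monic//= => qa pE.
pose V := row_base (geigenspace A a); pose W := row_base (kermxpoly A q).
have cpq : coprimep (('X - a%:P) ^+ n.+1) q.
  by rewrite coprimep_expl// coprimep_sym coprimep_XsubC.
have VW0 := mxdirect_kermxpoly A cpq.
(* [geigenspace] is defined with the exponent [n.+1], not [m]; this bound makes the characteristic
   polynomial divide [('X - a)^n.+1 * q]. *)
have mn : (m <= n.+1)%N.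
  have q0 : q != 0 by apply: contraNneq qa => ->; rewrite root0.
  have := size_char_poly A; rewrite pE size_Mmonic ?monic_exp ?monicXsubC//.
  rewrite size_exp_XsubC addnS /= => e; have := size_poly_gt0 q.
  by rewrite q0 => sq; rewrite -ltnS -e -add1n leq_add2r.
have VWT : (geigenspace A a + kermxpoly A q :=: 1%:M)%MS.
  apply: eqmx_trans (eqmx_sym (kermxpolyM _ cpq)) _.
  apply: kermxpoly_min; apply: dvdp_trans (mxminpoly_dvd_char A) _.
  by rewrite pE mulrC dvdp_mul// dvdp_exp2l.
have sV : stablemx V A by rewrite stablemx_row_base comm_mx_stable_geigenspace.
have sW : stablemx W A by rewrite stablemx_row_base comm_mx_stable_kermxpoly.
have fV : row_free V := row_base_free _.
have fW : row_free W := row_base_free _.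
have kl : (\rank (geigenspace A a) + \rank (kermxpoly A q) = n.+1)%N.
  by rewrite -mxrank_sum_cap VW0 mxrank0 addn0 VWT mxrank1.
have fVW : row_free (col_mx V W).
  rewrite /row_free -addsmxE (adds_eqmx (eq_row_base _) (eq_row_base _)).
  by rewrite VWT mxrank1 kl.
have := char_poly_direct kl fVW (esym (mulmxKpV sV)) (esym (mulmxKpV sW)).
rewrite -/(conjmx V A) -/(conjmx W A) => ->; rewrite mupMl; last first.
  apply: contra qa; apply: root_char_poly_conjmx => //.
  by rewrite eq_row_base.
set p := char_poly _.
have rp b : root p b -> b = a.
  move=> /(root_char_poly_conjmx fV sV (p := ('X - a%:P) ^+ n.+1)) rb.
  have /rb : (V <= kermxpoly A (('X - a%:P) ^+ n.+1))%MS by rewrite eq_row_base.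
  by rewrite root_exp_XsubC => /eqP.
rewrite (@closed_monic_single_root _ p a (char_poly_monic _) rp).
by rewrite size_char_poly mup_XsubCX eqxx.
Qed.

(** The minimal polynomial divides the product of [p] and all [('X - c x)^n.+1], so the kernel of
    that product at [A] is everything; it splits because the factors are pairwise coprime. *)
Lemma sum_geigenspace_complement (F : closedFieldType) (I : finType)
    (c : I -> F) n (A : 'M[F]_n) (p : {poly F}) :
  injective c ->
  char_poly A = (\prod_x ('X - (c x)%:P) ^+ mup (c x) (char_poly A)) * p ->
  (forall x, ~~ root p (c x)) ->
  (1%:M <= \sum_x geigenspace A (c x) + kermxpoly A p)%MS.
Proof.
case: n => [|n] in A *; first by rewrite [1%:M]flatmx0 sub0mx.
move=> c_inj pE pc; pose P := \prod_x ('X - (c x)%:P) ^+ n.+1.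
have cP : {in predT &, forall x y : I, y != x ->
    coprimep (('X - (c x)%:P) ^+ n.+1) (('X - (c y)%:P) ^+ n.+1)}.
  move=> x y _ _ xy; rewrite coprimep_expl// coprimep_expr// coprimep_XsubC.
  by rewrite root_XsubC (inj_eq c_inj).
have PE := kermxpoly_prod A cP; rewrite -/P in PE.
rewrite -(adds_eqmx PE (eqmx_refl _)) -kermxpolyM; last first.
  rewrite coprimep_sym /P; elim/big_ind: _ => [|f g pf pg|x _].
  - exact: coprimep1.
  - by rewrite coprimepMr pf.
  - by rewrite coprimep_expr// coprimep_XsubC.
rewrite kermxpoly_min//; apply: dvdp_trans (mxminpoly_dvd_char A) _.
rewrite pE dvdp_mul//; apply: (big_rec2 (fun f g => f %| g)) => // x f g _ fg.
(* A multiplicity is the rank of a subspace, hence at most [n.+1]. *)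
by rewrite dvdp_mul// dvdp_exp2l// -rank_geigenspace rank_leq_row.
Qed.

(** * Orthogonality of generalized eigenspaces for the form given by [H] *)

Section Structure.
Variable C : numClosedFieldType.

Lemma eps2_sqr (S : sclass) : eps2 S * eps2 S = 1 :> C.
Proof. by case: S; rewrite /= ?mulrNN mulr1. Qed.

Lemma conj_eps2 (S : sclass) : (eps2 S)^* = eps2 S :> C.
Proof. by case: S; rewrite /= ?rmorphN rmorph1. Qed.

Lemma adjD m n (A B : 'M[C]_(m, n)) : (A + B)^t* = A^t* + B^t*.
Proof. by rewrite linearD map_mxD. Qed.

Lemma adjB m n (A B : 'M[C]_(m, n)) : (A - B)^t* = A^t* - B^t*.
Proof. by rewrite linearB map_mxB. Qed.

Lemma adjZ m n a (A : 'M[C]_(m, n)) : (a *: A)^t* = a^* *: A^t*.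
Proof. by rewrite linearZ map_mxZ. Qed.

Lemma in_classP n (S : sclass) (H A : 'M[C]_n) : H \in unitmx ->
  in_class S H A <-> A^t* *m H = eps2 S *: (H *m A).
Proof.
move=> uH; have -> : in_class S H A <-> sadj H A = eps2 S *: A.
  by case: S; rewrite /= ?scaleN1r ?scale1r.
rewrite /sadj -mulmxA scalemxAr; split=> [<-|->]; first by rewrite mulKVmx.
by rewrite mulKmx.
Qed.

Lemma sub_geigenspaceP n k (A : 'M[C]_n.+1) a (V : 'M_(k, n.+1)) :
  reflect (V *m (A - a%:M) ^+ n.+1 = 0) (V <= geigenspace A a)%MS.
Proof. by rewrite geigenspaceE; apply: sub_kermxP. Qed.

Lemma tr_horner_mx n (A : 'M[C]_n.+1) (p : {poly C}) :
  horner_mx A^T p = (horner_mx A p)^T.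
Proof.
elim/poly_ind: p => [|p c IH]; first by rewrite !rmorph0 trmx0.
rewrite {1}mulrC !rmorphD !rmorphM /= !horner_mx_X !horner_mx_C IH linearD /=.
by rewrite trmx_mul tr_scalar_mx.
Qed.

Lemma sub_kermxpoly_trP n k (A : 'M[C]_n.+1) p (Y : 'M_(n.+1, k)) :
  reflect (horner_mx A p *m Y = 0) (Y^T <= kermxpoly A^T p)%MS.
Proof.
apply: (iffP sub_kermxP); rewrite tr_horner_mx -trmx_mul => pY; last first.
  by rewrite pY trmx0.
by apply: trmx_inj; rewrite pY trmx0.
Qed.

(** The class relation makes [H] intertwine [A - eps2 conj(a)] with [A^t* - conj(a)] up to the sign
    [eps2], and so also their powers. The conjugate of the equation saying that [Y] is generalized
    for [a] can then be moved across [H]. *)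
Lemma adj_geigenspace n k (S : sclass) (H A : 'M[C]_n) a (Y : 'M_(n, k)) :
  H \in unitmx -> in_class S H A -> (Y^T <= geigenspace A^T a)%MS ->
  (Y^t* *m H <= geigenspace A (eps2 S * a^*))%MS.
Proof.
move=> uH /(in_classP _ _ uH) AH.
case: n => [|n] in H A Y uH AH *; first by rewrite (thinmx0 (_ *m _)) sub0mx.
move=> /sub_geigenspaceP Ya; apply/sub_geigenspaceP.
pose M := A^t* - (a^*)%:M.
have YM : Y^t* *m M ^+ n.+1 = 0.
  have := congr1 (map_mx Num.conj) Ya.
  by rewrite map_mxM rmorphXn /= map_mxB map_scalar_mx map_mx0.
have HM : H *m (A - (eps2 S * a^*)%:M) = eps2 S *: (M *m H).
  rewrite mulmxBl AH mulmxBr scalerBr scalerA eps2_sqr scale1r; congr (_ - _).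
  by rewrite -scale_scalar_mx -scalemxAr scalar_mxC.
have HMk k' :
    H *m (A - (eps2 S * a^*)%:M) ^+ k' = eps2 S ^+ k' *: (M ^+ k' *m H).
  elim: k' => [|k' IH]; first by rewrite !expr0 scale1r mulmx1 mul1mx.
  rewrite !exprSr -!mulmxE mulmxA IH -scalemxAl -mulmxA HM -scalemxAr scalerA.
  by rewrite mulmxA.
by rewrite -mulmxA HMk -scalemxAr mulmxA YM mul0mx scaler0.
Qed.

(** A general [p] serves two purposes: a power of a linear factor for the Gram matrix and for single
    Jordan chains, and the cofactor of the characteristic polynomial for the complement of the
    chains. *)
Lemma geigenspace_orth n k l (S : sclass) (H A : 'M[C]_n) a p
    (Y : 'M_(n, k)) (Z : 'M_(n, l)) :
  H \in unitmx -> in_class S H A -> ~~ root p (eps2 S * a^*) ->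
  (Y^T <= geigenspace A^T a)%MS -> (Z^T <= kermxpoly A^T p)%MS ->
  Y^t* *m H *m Z = 0.
Proof.
case: n => [|n] in H A Y Z *.
  by move=> *; rewrite (flatmx0 Z) mulmx0.
move=> uH AS pa /(adj_geigenspace uH AS) /sub_kermxP Ya /sub_kermxpoly_trP.
apply: coprime_annihilators_mul0 Ya.
by rewrite coprimep_expl// coprimep_sym coprimep_XsubC.
Qed.

Section Columns.
Variables (n r : nat) (S : sclass) (H A : 'M[C]_n) (X : 'M[C]_(n, r)).
Variable c : 'I_r -> C.
Hypothesis unitH : H \in unitmx.
Hypothesis AS : in_class S H A.
Hypothesis Xc : forall k, ((col k X)^T <= geigenspace A^T (c k))%MS.

Lemma cols_orth l p (Z : 'M_(n, l)) :
  (forall k, ~~ root p (eps2 S * (c k)^*)) -> (Z^T <= kermxpoly A^T p)%MS ->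
  X^t* *m H *m Z = 0.
Proof.
move=> pc Zp; apply/row_matrixP => k; rewrite row0 !row_mul.
have -> : row k (X^t*) = (col k X)^t* by apply/rowP => j; rewrite !mxE.
exact: geigenspace_orth (pc k) (Xc k) Zp.
Qed.

(* The (k, l) entry of the Gram matrix vanishes unless c l is the partner of
   c k, and for partners the two sides agree. *)
Lemma gram_diag (d : 'rV[C]_r) :
  (forall k l, c l = eps2 S * (c k)^* -> d 0 l = eps2 S * (d 0 k)^*) ->
  (diag_mx d)^t* *m (X^t* *m H *m X)
  = eps2 S *: ((X^t* *m H *m X) *m diag_mx d).
Proof.
move=> dc; move GE : (X^t* *m H *m X) => G.
have -> : (diag_mx d)^t* = diag_mx (map_mx Num.conj d).
  by rewrite tr_diag_mx map_diag_mx.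
apply/matrixP => k l; rewrite mul_diag_mx mul_mx_diag !mxE.
have [cl|cl] := eqVneq (c l) (eps2 S * (c k)^*).
  rewrite (dc _ _ cl) -[LHS]mul1r -(eps2_sqr S) -mulrA [RHS]mulrA.
  by rewrite [RHS]mulrCA -[_ * G k l * _]mulrA [G k l * _]mulrC.
suff -> : G k l = 0 by rewrite mulr0 mul0r mulr0.
(* Column [l] is killed by a power of [A - c l], a polynomial that does not vanish at the partner of
   [c k]. *)
have Xl : ((col l X)^T <= kermxpoly A^T (('X - (c l)%:P) ^+ n))%MS := Xc l.
have := geigenspace_orth unitH AS _ (Xc k) Xl.
rewrite rootE horner_exp hornerXsubC expf_eq0 subr_eq0 (eq_sym _ (c l)).
rewrite (negPf cl) andbF => /(_ isT)/matrixP/(_ 0 0); rewrite !mxE => <-.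
rewrite -GE mxE; apply: eq_bigr => j _; rewrite !mxE; congr (_ * _).
by apply: eq_bigr => i _; rewrite !mxE.
Qed.

End Columns.

Lemma horner_mx_intertwine n d (A : 'M[C]_n.+1) (J : 'M_d.+1) Y p :
  A *m Y = Y *m J -> horner_mx A p *m Y = Y *m horner_mx J p.
Proof.
move=> AY; elim/poly_ind: p => [|p c IH].
  by rewrite !rmorph0 mul0mx mulmx0.
rewrite !rmorphD !rmorphM /= !horner_mx_X !horner_mx_C mulmxDl mulmxDr.
by rewrite -mulmxA AY mulmxA IH -mulmxA scalar_mxC.
Qed.

Lemma char_poly_jordan_block d (a : C) :
  char_poly (jordan_block d a) = ('X - a%:P) ^+ d.
Proof.
rewrite -char_poly_tr char_poly_trig.
  under eq_bigr do rewrite !mxE eqxx.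
  by rewrite prodr_const card_ord.
apply/is_trig_mxP => i j ij; rewrite !mxE eq_sym -val_eqE /= ltn_eqF//.
by rewrite ltn_eqF// ltnW.
Qed.

(** Cayley-Hamilton for the Jordan block, transported along [A Y = Y J]. *)
Lemma jordan_pair_sub_kermxpoly n d (A : 'M[C]_n) a (Y : 'M_(n, d)) :
  jordan_pair A a Y -> (Y^T <= kermxpoly A^T (('X - a%:P) ^+ d))%MS.
Proof.
case=> d0 _ _ AY; case: d d0 Y AY => [|d] // _ Y AY.
case: n => [|n] in A Y AY *; first by rewrite [Y^T]thinmx0 sub0mx.
apply/sub_kermxpoly_trP; rewrite (horner_mx_intertwine _ AY).
by rewrite -char_poly_jordan_block Cayley_Hamilton mulmx0.
Qed.

End Structure.

(** * Structured solutions of [dA X = X D] and the Gram matrix *)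

Lemma invmx_intertwine (F : fieldType) n (G D D' : 'M[F]_n) c :
  G \in unitmx -> D' *m G = c *: (G *m D) ->
  invmx G *m D' = c *: (D *m invmx G).
Proof.
move=> uG GD; rewrite -[D'](mulmxK uG) GD -!scalemxAl -scalemxAr.
by rewrite -[G *m D *m _]mulmxA mulKmx.
Qed.

Lemma perturbed_mulmxP (R : pzRingType) n r (A E : 'M[R]_n)
    (X : 'M_(n, r)) L L' :
  A *m X = X *m L -> E *m X = X *m (L' - L) <-> (A + E) *m X = X *m L'.
Proof.
by move=> AX; rewrite mulmxBr mulmxDl AX; split=> [->|<-];
  rewrite addrC ?subrK ?addKr.
Qed.

Section PrescribedAction.
Variable C : numClosedFieldType.
Variables (n r : nat) (S : sclass) (H : 'M[C]_n) (eps1 : C).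
Variables (X : 'M[C]_(n, r)) (D : 'M[C]_r).
Hypothesis unitH : H \in unitmx.
Hypothesis eps1E : eps1 = 1 \/ eps1 = -1.
Hypothesis adjH : H^t* = eps1 *: H.

Let G : 'M[C]_r := X^t* *m H *m X.
Let Xd := mpinv X.

Lemma sign_sqr : eps1 * eps1 = 1.
Proof. by case: eps1E => ->; rewrite ?mulrNN mulr1. Qed.

Lemma conj_sign : eps1^* = eps1.
Proof. by case: eps1E => ->; rewrite ?rmorphN rmorph1. Qed.

(** Turns membership in the class into the symmetry condition imposed on the free parameter [Z]. *)
Lemma in_class_formP (E : 'M[C]_n) :
  in_class S H E <-> (H *m E)^t* = (eps1 * eps2 S) *: (H *m E).
Proof.
apply: iff_trans (in_classP S E unitH) _.
rewrite adjM adjH -scalemxAr -scalerA; split=> [-> //|].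
by move/(congr1 ( *:%R eps1)); rewrite !scalerA sign_sqr mul1r scale1r.
Qed.

Lemma adj_gram : G^t* = eps1 *: G.
Proof. by rewrite /G !adjM trmxCK adjH -scalemxAl -scalemxAr mulmxA. Qed.

(** Full column rank allows cancelling [X] on the left in [X Xd X = X]. *)
Lemma mpinv_mulmx : row_free X^T -> Xd *m X = 1%:M.
Proof.
move=> fX; have /and4P[/eqP XdX _ _ _] := mpinvP X.
apply: trmx_inj; rewrite trmx1; apply: (row_free_inj fX).
by rewrite -trmx_mul mulmxA XdX mul1mx.
Qed.

Lemma adj_sign_sym m k (U : 'M[C]_(m, k)) V :
  U^t* = (eps1 * eps2 S) *: V -> V^t* = (eps1 * eps2 S) *: U.
Proof.
move=> UV; have ss : eps1 * eps2 S * (eps1 * eps2 S) = 1.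
  by rewrite mulrACA sign_sqr eps2_sqr mulr1.
rewrite -[U in RHS]trmxCK UV adjZ scalerA rmorphM /= conj_sign conj_eps2.
by rewrite ss scale1r.
Qed.

Hypothesis GD : D^t* *m G = eps2 S *: (G *m D).

Lemma structured_solutionsP (dA : 'M[C]_n) : row_free X^T ->
  in_class S H dA /\ dA *m X = X *m D <->
  exists2 Z : 'M[C]_n, Z^t* = (eps1 * eps2 S) *: Z
    & dA = X *m D *m Xd
           + eps2 S *: (invmx H *m Xd^t* *m D^t* *m X^t* *m H)
           - invmx H *m Xd^t* *m X^t* *m H *m X *m D *m Xd
           + invmx H *m (1%:M - X *m Xd) *m Z *m (1%:M - X *m Xd).
Proof.
move=> fX; have XdX := mpinv_mulmx fX.
have /and4P[_ _ /eqP adjP _] := mpinvP X; rewrite -/Xd in adjP.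
set P := X *m Xd in adjP *; set Q := 1%:M - P.
have adjQ : Q^t* = Q by rewrite adjB adjP trmx1 map_scalar_mx rmorph1.
(* For a solution with [K = H dA], these three terms are [K P], [P K] and [P K P]. *)
pose T1 := H *m X *m D *m Xd.
pose T2 := eps2 S *: (Xd^t* *m D^t* *m X^t* *m H).
pose T3 := Xd^t* *m G *m D *m Xd.
have T1E : T1^t* = (eps1 * eps2 S) *: T2.
  rewrite /T1 /T2 !adjM adjH scalerA -mulrA eps2_sqr mulr1 -!scalemxAr.
  by rewrite !mulmxA.
have T2E : T2^t* = (eps1 * eps2 S) *: T1.
  exact: adj_sign_sym T1E.
have rhsE (Q' Z : 'M_n) : X *m D *m Xd
    + eps2 S *: (invmx H *m Xd^t* *m D^t* *m X^t* *m H)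
    - invmx H *m Xd^t* *m X^t* *m H *m X *m D *m Xd + invmx H *m Q' *m Z *m Q'
    = invmx H *m (T1 + T2 - T3 + Q' *m Z *m Q').
  rewrite /T1 /T2 /T3 /G mulmxDr mulmxBr mulmxDr -!scalemxAr !mulmxA.
  by rewrite mulVmx// mul1mx.
split=> [[/in_class_formP dAS dAX] | [Z Zadj]].
  (* The free parameter can be [K] itself, since only its compression [Q K Q] enters. *)
  exists (H *m dA) => //; rewrite rhsE; set K := H *m dA in dAS *.
  have T1K : T1 = K *m P.
    by rewrite /T1 /K /P !mulmxA -(mulmxA H dA) dAX !mulmxA.
  have T2K : T2 = P *m K.
    apply: (can_inj (@trmxCK _ _ _)).
    by rewrite T2E T1K adjM adjP dAS -scalemxAl.
  have T3K : T3 = P *m K *m P.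
    by rewrite -mulmxA -T1K -adjP /P adjM /T3 /T1 /G !mulmxA.
  apply: (can_inj (mulKmx unitH)).
  rewrite mulKVmx// -/K T1K T2K T3K /Q mulmxBr mulmx1 mulmxBl mul1mx mulmxBl.
  rewrite -[RHS](addrC (_ - _)) -[X in X + _]addrA -opprD [P *m K + _]addrA.
  by rewrite [P *m K + _]addrC subrK.
rewrite rhsE => dAE; have HdA : H *m dA = T1 + T2 - T3 + Q *m Z *m Q.
  by rewrite dAE mulKVmx.
(* The first two terms are exchanged by the adjoint, up to sign; the symmetry of the third needs the
   compatibility [GD]. *)
have T3E : T3^t* = (eps1 * eps2 S) *: T3.
  rewrite /T3 3!adjM trmxCK adj_gram -scalemxAl -!scalemxAr (mulmxA (D^t*)) GD.
  by rewrite -scalemxAl -scalemxAr scalerA !mulmxA.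
split.
  apply/in_class_formP; rewrite HdA adjD adjB adjD T1E T2E T3E !adjM adjQ Zadj.
  rewrite -scalemxAl -scalemxAr mulmxA -!scalerDr -scalerBr -scalerDr.
  by rewrite (addrC T1).
have PX : P *m X = X by rewrite /P -mulmxA XdX mulmx1.
have QX : Q *m X = 0 by rewrite /Q mulmxBl mul1mx PX subrr.
(* By [GD] the second and third terms agree on [X] and cancel, leaving [T1 X = H X D]. *)
have T2X : T2 *m X = T3 *m X.
  have -> : T2 *m X = eps2 S *: (Xd^t* *m (D^t* *m G)).
    by rewrite /T2 /G -scalemxAl !mulmxA.
  by rewrite GD -scalemxAr scalerA eps2_sqr scale1r /T3 -!mulmxA XdX mulmx1.
apply: (can_inj (mulKmx unitH)); rewrite mulmxA HdA mulmxDl mulmxBl mulmxDl.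
by rewrite T2X addrK -(mulmxA (Q *m Z)) QX mulmx0 addr0 -!mulmxA XdX mulmx1.
Qed.

(** Inverting [G] in [GD] shows that [D G^-1] has the symmetry sign [eps1 * eps2]; the congruence by
    [H X], with [H] Hermitian up to [eps1], preserves it. *)
Lemma gram_perturbation_in_class : G \in unitmx ->
  in_class S H (X *m D *m invmx G *m X^t* *m H).
Proof.
move=> uG; apply/in_class_formP.
have GDV := invmx_intertwine uG GD.
have adjGV : (invmx G)^t* = eps1 *: invmx G.
  rewrite trmx_inv map_invmx adj_gram.
  have u1 : eps1 \is a GRing.unit by case: eps1E => ->; rewrite ?unitrN unitr1.
  rewrite invmxZ ?unitmxZ//; congr (_ *: _).
  by case: eps1E => ->; rewrite ?invrN invr1.
rewrite !mulmxA 5!adjM trmxCK adjH adjGV -!scalemxAl -!scalemxAr.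
rewrite (mulmxA (invmx G)) GDV -scalemxAl -!scalemxAr !scalerA !mulmxA.
by rewrite sign_sqr mul1r.
Qed.

Lemma gram_perturbation_mulmx : G \in unitmx ->
  X *m D *m invmx G *m X^t* *m H *m X = X *m D.
Proof. by move=> uG; rewrite -!mulmxA (mulmxA _ H) mulVmx ?mulmx1. Qed.

End PrescribedAction.

(** If [K G = 0], then [K X^t* H] kills the columns of [X] and of [M^T], which span the space, so it
    is 0; independence of the columns of [X] and invertibility of [H] give [K = 0]. *)
Lemma gram_unitmx (C : numClosedFieldType) n r m (H : 'M[C]_n)
    (X : 'M_(n, r)) (M : 'M_(m, n)) :
  H \in unitmx -> row_free X^T -> X^t* *m H *m M^T = 0 ->
  (1%:M <= X^T + M)%MS -> X^t* *m H *m X \in unitmx.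
Proof.
move=> uH fX XM XM1; rewrite -row_free_unit -kermx_eq0; apply/eqP.
set K := kermx _; set y := K *m (X^t* *m H).
have yX : y *m X = 0 by rewrite -mulmxA mulmx_ker.
have yM : y *m M^T = 0 by rewrite -mulmxA XM mulmx0.
have y0 : y = 0.
  apply: trmx_inj; rewrite trmx0 -[LHS]mul1mx; apply/sub_kermxP.
  apply: submx_trans XM1 _; rewrite addsmx_sub.
  by apply/andP; split; apply/sub_kermxP; apply: trmx_inj;
    rewrite trmx_mul !trmxK trmx0.
have fX' : row_free (X^t*) by rewrite row_free_map.
apply: (row_free_inj fX'); rewrite mul0mx.
by apply: (can_inj (mulmxK uH)); rewrite mul0mx -mulmxA.
Qed.

(** * Block bookkeeping for the chain matrix and the Jordan matrices *)

Section Chains.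
Variables (C : numClosedFieldType) (q s : nat).
Variables (mp : 'I_q -> nat) (dp : forall i, 'I_(mp i) -> nat).
Variables (ms : 'I_s -> nat) (ds : forall j, 'I_(ms j) -> nat).

(* inl (inl i) stands for the chains of lam_i, inl (inr i) for those of
   eps2 S * conj(lam_i), inr j for those of the self-paired lams_j. *)
Definition chain_group : finType := ('I_q + 'I_q + 'I_s)%type.

Definition group_val T (f g : 'I_q -> T) (h : 'I_s -> T)
    (x : chain_group) : T :=
  match x with inl (inl i) => f i | inl (inr i) => g i | inr j => h j end.

(** On eigenvalues this is the involution [z |-> eps2 conj(z)]. *)
Definition group_conj (x : chain_group) : chain_group :=
  match x with
  | inl (inl i) => inl (inr i)
  | inl (inr i) => inl (inl i)
  | inr j => inr j
  end.

Local Notation chains n := (forall i (l : 'I_(mp i)), 'M[C]_(n, dp l)).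
Local Notation schains n := (forall j (l : 'I_(ms j)), 'M[C]_(n, ds l)).

(** The group is chosen before the chains, their height and the property, so one choice serves both
    the actual chains and the rows of values attached to them. *)
Lemma chain_mx_colP (k : 'I_(total_size dp ds)) :
  exists x : chain_group, forall n (X Xt : chains n) (Xs : schains n)
    (P : chain_group -> 'cV[C]_n -> Prop),
    (forall i l t, P (inl (inl i)) (col t (X i l))) ->
    (forall i l t, P (inl (inr i)) (col t (Xt i l))) ->
    (forall j l t, P (inr j) (col t (Xs j l))) ->
  P x (col k (chain_mx X Xt Xs)).
Proof.
have colL m n1 n2 (U : 'M[C]_(m, n1)) (V : 'M[C]_(m, n2)) t :
  col (lshift n2 t) (row_mx U V) = col t U.
  by apply/colP => z; rewrite !mxE -[lshift n2 t]/(unsplit (inl t)) unsplitK.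
have colR m n1 n2 (U : 'M[C]_(m, n1)) (V : 'M[C]_(m, n2)) t :
  col (rshift n1 t) (row_mx U V) = col t V.
  by apply/colP => z; rewrite !mxE -[rshift n1 t]/(unsplit (inr t)) unsplitK.
rewrite /chain_mx; case: (split_ordP k) => k' ->.
  case: (split_ordP (tagnat.sig2 k')) => t tE.
    exists (inl (inl (tagnat.sig1 k'))) => n X Xt Xs P PX _ _.
    by rewrite colL col_mxrow tE colL col_mxrow.
  exists (inl (inr (tagnat.sig1 k'))) => n X Xt Xs P _ PX _.
  by rewrite colL col_mxrow tE colR col_mxrow.
exists (inr (tagnat.sig1 k')) => n X Xt Xs P _ _ PX.
by rewrite colR !col_mxrow.
Qed.

(* Applied to constant blocks of height 1, chain_mx lists for each column the
   value attached to its group. *)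
Definition group_row (f g : 'I_q -> C) (h : 'I_s -> C) :
    'rV[C]_(total_size dp ds) :=
  chain_mx (fun i l => const_mx (f i)) (fun i l => const_mx (g i))
    (fun j l => const_mx (h j)).

Lemma eq_chain_mxP n (X Xt Y Yt : chains n) (Xs Ys : schains n) :
  chain_mx X Xt Xs = chain_mx Y Yt Ys <->
  [/\ forall i l, X i l = Y i l, forall i l, Xt i l = Yt i l
    & forall j l, Xs j l = Ys j l].
Proof.
split=> [/eq_row_mx[/eq_mxrowP XY /eq_mxrowP XYs] | [XY XYt XYs]].
  split=> [i l|i l|j l]; last by have /eq_mxrowP := XYs j; apply.
    by have /eq_row_mx[/eq_mxrowP + _] := XY i; apply.
  by have /eq_row_mx[_ /eq_mxrowP] := XY i; apply.
congr row_mx; apply: eq_mxrow => i; last exact: eq_mxrow.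
by congr row_mx; apply: eq_mxrow.
Qed.

Lemma mulmx_chain n (A : 'M_n) (X Xt : chains n) (Xs : schains n) :
  A *m chain_mx X Xt Xs = chain_mx (fun i l => A *m X i l)
    (fun i l => A *m Xt i l) (fun j l => A *m Xs j l).
Proof.
rewrite /chain_mx mul_mx_row !mul_mxrow; congr row_mx; apply: eq_mxrow => i.
  by rewrite mul_mx_row !mul_mxrow.
by rewrite mul_mxrow.
Qed.

Lemma chain_mulmx_jordan n (S : sclass) (lam : 'I_q -> C) (lams : 'I_s -> C)
    (X Xt : chains n) (Xs : schains n) :
  chain_mx X Xt Xs *m jordan_mx dp ds S lam lams
  = chain_mx (fun i l => X i l *m jordan_block (dp l) (lam i))
      (fun i l => Xt i l *m jordan_block (dp l) (eps2 S * (lam i)^*))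
      (fun j l => Xs j l *m jordan_block (ds l) (lams j)).
Proof.
rewrite /chain_mx /jordan_mx mul_row_block !mulmx0 addr0 add0r.
rewrite !mul_mxrow_mxdiag; congr row_mx; apply: eq_mxrow => i.
  by rewrite mul_row_block !mulmx0 addr0 add0r !mul_mxrow_mxdiag.
by rewrite mul_mxrow_mxdiag.
Qed.

Lemma jordan_blockB d (a b : C) :
  jordan_block d a - jordan_block d b = diag_mx (const_mx (a - b)).
Proof.
apply/matrixP => i j; rewrite !mxE; case: (i =P j) => // _.
by rewrite subrr.
Qed.

(** Blocks of equal size have the same superdiagonal, so the difference is diagonal even for
    nontrivial Jordan chains. *)
Lemma jordan_mxB (S : sclass) (a b : 'I_q -> C) (as_ bs : 'I_s -> C) :
  jordan_mx dp ds S a as_ - jordan_mx dp ds S b bs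
  = diag_mx (group_row (fun i => a i - b i)
      (fun i => eps2 S * (a i)^* - eps2 S * (b i)^*) (fun j => as_ j - bs j)).
Proof.
rewrite /jordan_mx opp_block_mx add_block_mx !subr0 -!mxdiagB.
rewrite /group_row /chain_mx diag_mx_row !diag_mxrow.
congr block_mx; apply: eq_mxdiag => i; last first.
  by rewrite -mxdiagB diag_mxrow; apply: eq_mxdiag => l; rewrite jordan_blockB.
rewrite opp_block_mx add_block_mx !subr0 -!mxdiagB diag_mx_row !diag_mxrow.
by congr block_mx; apply: eq_mxdiag => l; rewrite jordan_blockB.
Qed.

End Chains.

Lemma enum_sum (T1 T2 : finType) :
  enum {: T1 + T2} = map inl (enum T1) ++ map inr (enum T2).
Proof. by rewrite !enumT [in LHS]unlock. Qed.

(** * Spectral data of [A] and the chain matrix *)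

Section Spectrum.
Variables (C : numClosedFieldType) (n q s : nat) (S : sclass) (A : 'M[C]_n).
Variables (mp : 'I_q -> nat) (dp : forall i, 'I_(mp i) -> nat).
Variables (ms : 'I_s -> nat) (ds : forall j, 'I_(ms j) -> nat).
Variables (lam : 'I_q -> C) (lams : 'I_s -> C).
Variables (X Xt : forall i (l : 'I_(mp i)), 'M[C]_(n, dp l)).
Variables (Xs : forall j (l : 'I_(ms j)), 'M[C]_(n, ds l)).
Hypothesis XE : forall i, complete_collection A (lam i) (@X i).
Hypothesis XtE : forall i, complete_collection A (eps2 S * (lam i)^*) (@Xt i).
Hypothesis XsE : forall j, complete_collection A (lams j) (@Xs j).

Definition group_eig : chain_group q s -> C :=
  group_val lam (fun i => eps2 S * (lam i)^*) lams.

Lemma eig_listE : eig_list S lam lams = [seq group_eig x | x : chain_group q s].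
Proof.
rewrite /eig_list /image_mem /chain_group !enum_sum !map_cat -!map_comp catA.
by congr (_ ++ _).
Qed.

Lemma group_eig_inj : uniq (eig_list S lam lams) -> injective group_eig.
Proof. by rewrite eig_listE => /injectiveP. Qed.

Lemma mem_eig_list x : group_eig x \in eig_list S lam lams.
Proof. by rewrite eig_listE image_f. Qed.

Lemma complete_collection_rank a m (d : 'I_m -> nat)
    (Y : forall l, 'M[C]_(n, d l)) : complete_collection A a Y ->
  \rank (geigenspace A^T a) = (\sum_l d l)%N.
Proof. by case=> _ _ _ fY /eqmxP <-; apply/eqP. Qed.

Lemma chain_mx_span :
  ((chain_mx X Xt Xs)^T :=: \sum_x geigenspace A^T (group_eig x))%MS.
Proof.
rewrite /chain_mx tr_row_mx !tr_mxrow !big_sumType /=.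
apply: eqmx_trans (eqmx_sym (addsmxE _ _)) _.
apply: adds_eqmx; apply: eqmx_trans (eqmx_col _) _; last first.
  apply: eqmx_sums => j _; apply: eqmx_trans (genmxE _) _.
  by case: (XsE j) => _ _ _ _ /eqmxP.
rewrite -big_split /=; apply: eqmx_sums => i _.
apply: eqmx_trans (genmxE _) _; rewrite tr_row_mx.
apply: eqmx_trans (eqmx_sym (addsmxE _ _)) _; apply: adds_eqmx.
  by case: (XE i) => _ _ _ _ /eqmxP.
by case: (XtE i) => _ _ _ _ /eqmxP.
Qed.

(** Generalized eigenspaces for distinct eigenvalues are in direct sum, so their ranks add up to the
    number of columns. *)
Lemma chain_mx_free : uniq (eig_list S lam lams) ->
  row_free (chain_mx X Xt Xs)^T.
Proof.
move=> /group_eig_inj c_inj; rewrite /row_free chain_mx_span.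
have /mxdirectP -> : mxdirect (\sum_x geigenspace A^T (group_eig x)).
  by apply: mxdirect_sum_geigenspace => x y _ _; apply: c_inj.
rewrite /= !big_sumType /= /total_size /pair_size /self_size big_split /=.
apply/eqP; congr (_ + _ + _)%N; apply: eq_bigr => i _.
- exact: complete_collection_rank (XE i).
- exact: complete_collection_rank (XtE i).
- exact: complete_collection_rank (XsE i).
Qed.

Lemma sub_col_geigenspace a m (d : 'I_m -> nat)
    (Y : forall l, 'M[C]_(n, d l)) l t : complete_collection A a Y ->
  ((col t (Y l))^T <= geigenspace A^T a)%MS.
Proof.
case=> _ _ _ _ /andP[+ _]; apply: submx_trans.
rewrite tr_col; apply: submx_trans (row_sub _ _) _.
by rewrite tr_mxrow eqmx_col (sumsmx_sup l)// genmxE.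
Qed.

Lemma chain_mx_groups : exists g : 'I_(total_size dp ds) -> chain_group q s,
  (forall k, ((col k (chain_mx X Xt Xs))^T
     <= geigenspace A^T (group_eig (g k)))%MS) /\
  (forall (a b : 'I_q -> C) c k,
     group_row dp ds a b c 0 k = group_val a b c (g k)).
Proof.
have [g gP] := fin_all_exists (chain_mx_colP C (dp := dp) (ds := ds)).
exists g; split=> [k|a b c k].
  apply: (gP k n X Xt Xs
    (fun x v => (v^T <= geigenspace A^T (group_eig x))%MS)).
  - by move=> i l t; apply: sub_col_geigenspace (XE i).
  - by move=> i l t; apply: sub_col_geigenspace (XtE i).
  - by move=> i l t; apply: sub_col_geigenspace (XsE i).
have -> : group_row dp ds a b c 0 k = col k (group_row dp ds a b c) 0 0.
  by rewrite [RHS]mxE.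
(* The same [g] is applied to chains of height 1 with constant entries. *)
by apply: (gP k 1 _ _ _ (fun x v => v 0 0 = group_val a b c x)) => *;
  rewrite !mxE.
Qed.

Hypothesis lams_self : forall j, lams j = eps2 S * (lams j)^*.
Hypothesis eig_uniq : uniq (eig_list S lam lams).

Lemma eps2_conjK (z : C) : eps2 S * (eps2 S * z^*)^* = z.
Proof. by rewrite rmorphM /= conj_eps2 conjCK mulrA eps2_sqr mul1r. Qed.

Lemma group_eig_conj x : group_eig (group_conj x) = eps2 S * (group_eig x)^*.
Proof. by case: x => [[i|i]|j] //=; rewrite /group_eig /= ?eps2_conjK. Qed.

Variable H : 'M[C]_n.
Hypothesis unitH : H \in unitmx.
Hypothesis AS : in_class S H A.
Variables (a : 'I_q -> C) (as_ : 'I_s -> C).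
Hypothesis as_self : forall j, as_ j = eps2 S * (as_ j)^*.

Let Xc := chain_mx X Xt Xs.
Let Lc := jordan_mx dp ds S lam lams.
Let La := jordan_mx dp ds S a as_.

Lemma chain_gram : (La - Lc)^t* *m (Xc^t* *m H *m Xc)
  = eps2 S *: ((Xc^t* *m H *m Xc) *m (La - Lc)).
Proof.
have [g [Xg gP]] := chain_mx_groups.
rewrite /La /Lc jordan_mxB; apply: (gram_diag unitH AS Xg) => k l.
(* Distinctness of the eigenvalues turns an equality of partner values into one of groups, on which
   the differences of new and old eigenvalues are compared. *)
rewrite -group_eig_conj => /(group_eig_inj eig_uniq) gl; rewrite !gP gl.
case: (g k) => [[i|i]|j] /=; rewrite ?rmorphB ?mulrBr ?eps2_conjK //=.
by rewrite -as_self -lams_self.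
Qed.

Lemma chain_orth l p (Z : 'M_(n, l)) :
  (forall x, ~~ root p (group_eig x)) -> (Z^T <= kermxpoly A^T p)%MS ->
  Xc^t* *m H *m Z = 0.
Proof.
move=> px; have [g [Xg _]] := chain_mx_groups.
by apply: (cols_orth unitH AS Xg) => k; rewrite -group_eig_conj.
Qed.

Lemma chain_eigen : A *m Xc = Xc *m Lc.
Proof.
rewrite mulmx_chain chain_mulmx_jordan; apply/eq_chain_mxP.
split=> [i l|i l|j l].
- by case: (XE i) => _ _ /(_ l)[].
- by case: (XtE i) => _ _ /(_ l)[].
- by case: (XsE j) => _ _ /(_ l)[].
Qed.

(** The first column of the chain is an eigenvector, nonzero by independence, so the chain equation
    already forces the eigenvalue. *)
Lemma jordan_pair_intro d (B : 'M_n) b (Y : 'M[C]_(n, d)) :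
  (0 < d)%N -> row_free Y^T -> B *m Y = Y *m jordan_block d b ->
  jordan_pair B b Y.
Proof.
case: d Y => // d Y _ fY BY; split=> //; apply/eigenvalueP.
exists (row 0 Y^T); last first.
  apply/eqP => Y0; have := mulmx_free_eq0 (delta_mx 0 0 : 'rV_d.+1) fY.
  rewrite -rowE Y0 eqxx => /esym/eqP/matrixP/(_ 0 0)/eqP.
  by rewrite !mxE !eqxx oner_eq0.
rewrite -row_mul -trmx_mul BY; apply/rowP => i; rewrite !mxE.
rewrite (bigD1 0) //= big1 ?addr0 => [|k k0]; first by rewrite !mxE eqxx mulrC.
by rewrite !mxE (negPf k0) mulr0.
Qed.

Lemma jordan_pairs_perturbedP (dA : 'M[C]_n) :
  [/\ forall i l, jordan_pair (A + dA) (a i) (@X i l),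
      forall i l, jordan_pair (A + dA) (eps2 S * (a i)^*) (@Xt i l)
    & forall j l, jordan_pair (A + dA) (as_ j) (@Xs j l)]
  <-> dA *m Xc = Xc *m (La - Lc).
Proof.
apply: iff_trans (iff_sym (perturbed_mulmxP dA La chain_eigen)).
rewrite mulmx_chain chain_mulmx_jordan; split=> [[P1 P2 P3]|].
  apply/eq_chain_mxP; split=> [i l|i l|j l]; first by case: (P1 i l).
    by case: (P2 i l).
  by case: (P3 j l).
case/eq_chain_mxP => E1 E2 E3; split=> [i l|i l|j l];
  apply: jordan_pair_intro => //.
- by case: (XE i) => _ _ /(_ l)[].
- by case: (XE i) => _ _ /(_ l)[].
- by case: (XtE i) => _ _ /(_ l)[].
- by case: (XtE i) => _ _ /(_ l)[].
- by case: (XsE j) => _ _ /(_ l)[].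
- by case: (XsE j) => _ _ /(_ l)[].
Qed.

Lemma alg_multE b m (d : 'I_m -> nat) (Y : forall l, 'M[C]_(n, d l)) :
  complete_collection A b Y -> alg_mult A b = (\sum_l d l)%N.
Proof.
by move/complete_collection_rank <-; rewrite rank_geigenspace char_poly_tr.
Qed.

(** The factor 2 arises because the chains of partner eigenvalues share the sizes [dp]. *)
Lemma total_sizeE : total_size dp ds
  = (\sum_(i < q) 2 * alg_mult A (lam i) + \sum_(j < s) alg_mult A (lams j))%N.
Proof.
congr (_ + _)%N; apply: eq_bigr => i _.
  by rewrite (alg_multE (XE i)) mul2n -addnn.
by rewrite (alg_multE (XsE i)).
Qed.

Lemma jordan_mxB_unit :
  (forall i, a i <> lam i) -> (forall j, as_ j <> lams j) ->
  La - Lc \in unitmx.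
Proof.
move=> al als; have [g [_ gP]] := chain_mx_groups.
rewrite /La /Lc jordan_mxB unitmxE det_diag unitfE prodf_seq_neq0.
apply/allP => k _ /=; rewrite gP; case: (g k) => [[i|i]|j] /=.
- by rewrite subr_eq0; apply/eqP/al.
(* Applying the involution [z |-> eps2 conj(z)] reduces the partner entry to the previous case. *)
- rewrite subr_eq0; apply/eqP => /(congr1 (fun z => eps2 S * z^*)).
  by rewrite !eps2_conjK; apply: al.
- by rewrite subr_eq0; apply/eqP/als.
Qed.

Lemma chain_span_rest p :
  char_poly A =
    (\prod_(z <- eig_list S lam lams) ('X - z%:P) ^+ alg_mult A z) * p ->
  (forall x, ~~ root p (group_eig x)) ->
  (1%:M <= Xc^T + kermxpoly A^T p)%MS.
Proof.
rewrite eig_listE big_image /= => pE pc.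
rewrite (adds_eqmx chain_mx_span (eqmx_refl _)).
apply: sum_geigenspace_complement (group_eig_inj eig_uniq) _ pc.
by rewrite char_poly_tr.
Qed.

End Spectrum.

(** * Parametrization of the structured perturbations and the no spillover update *)

Theorem theorem3p4 (R : realType) (n : nat) (S : sclass)
    (H : 'M[R[i]]_n) (eps1 : R[i]) (A : 'M[R[i]]_n)
    (p q : nat)
    (mp : 'I_q -> nat) (dp : forall i : 'I_q, 'I_(mp i) -> nat)
    (ms : 'I_(p - q.*2) -> nat)
    (ds : forall j : 'I_(p - q.*2), 'I_(ms j) -> nat)
    (lamc lama : 'I_q -> R[i]) (lamcs lamas : 'I_(p - q.*2) -> R[i])
    (X Xt : forall (i : 'I_q) (l : 'I_(mp i)), 'M[R[i]]_(n, dp i l))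
    (Xs : forall (j : 'I_(p - q.*2)) (l : 'I_(ms j)), 'M[R[i]]_(n, ds j l)) :
  H \is unitarymx ->
  eps1 = 1 \/ eps1 = -1 ->
  H^t* = eps1 *: H ->
  in_class S H A ->
  (q.*2 <= p)%N ->
  (forall i, complete_collection A (lamc i) (X i)) ->
  (forall i, complete_collection A (eps2 S * (lamc i)^*) (Xt i)) ->
  (forall j, complete_collection A (lamcs j) (Xs j)) ->
  (forall i, lamc i <> eps2 S * (lamc i)^*) ->
  (forall j, lamcs j = eps2 S * (lamcs j)^*) ->
  uniq (eig_list S lamc lamcs) ->
  (forall i, lama i <> eps2 S * (lama i)^*) ->
  (forall j, lamas j = eps2 S * (lamas j)^*) ->
  let Xc := chain_mx X Xt Xs in
  let Lc := jordan_mx dp ds S lamc lamcs in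
  let La := jordan_mx dp ds S lama lamas in
  let Xd := mpinv Xc in
  (forall dA : 'M[R[i]]_n,
     [/\ in_class S H dA,
         forall i l, jordan_pair (A + dA) (lama i) (X i l),
         forall i l, jordan_pair (A + dA) (eps2 S * (lama i)^*) (Xt i l)
       & forall j l, jordan_pair (A + dA) (lamas j) (Xs j l)]
     <->
     exists2 Z : 'M[R[i]]_n, Z^t* = (eps1 * eps2 S) *: Z
       & dA = Xc *m (La - Lc) *m Xd
              + eps2 S *: (invmx H *m Xd^t* *m (La - Lc)^t* *m Xc^t* *m H)
              - invmx H *m Xd^t* *m Xc^t* *m H *m Xc *m (La - Lc) *m Xd
              + invmx H *m (1%:M - Xc *m Xd) *m Z *m (1%:M - Xc *m Xd))
  /\
  (forall (r : nat) (lamf : 'I_(n - r) -> R[i]),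
     r = (\sum_(i < q) 2 * alg_mult A (lamc i)
          + \sum_(j < p - q.*2) alg_mult A (lamcs j))%N ->
     char_poly A =
       (\prod_(z <- eig_list S lamc lamcs) ('X - z%:P) ^+ alg_mult A z)
       * (\prod_(k < n - r) ('X - (lamf k)%:P)) ->
     (forall k, lamf k \notin eig_list S lamc lamcs) ->
     let dA := Xc *m (La - Lc) *m invmx (Xc^t* *m H *m Xc) *m Xc^t* *m H in
     [/\ Xc^t* *m H *m Xc \in unitmx,
         no_spillover S H A Xc La lamf dA,
         (\rank dA <= r)%N
       & (forall i, lama i <> lamc i) -> (forall j, lamas j <> lamcs j) ->
         \rank dA = r]).
Proof.
move=> unitaryH eps1E adjH AS _ XE XtE XsE _ lamcs_self eig_uniq _ lamas_self.
move=> Xc Lc La Xd; have unitH := unitarymx_unit unitaryH.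
have fX : row_free Xc^T := chain_mx_free XE XtE XsE eig_uniq.
have GD : (La - Lc)^t* *m (Xc^t* *m H *m Xc)
    = eps2 S *: ((Xc^t* *m H *m Xc) *m (La - Lc)).
  exact: (chain_gram XE XtE XsE lamcs_self eig_uniq unitH AS lama lamas_self).
split=> [dA|r lamf rE pE lamfN dA].
  apply: iff_trans _ (structured_solutionsP unitH eps1E adjH GD dA fX).
  have JP := jordan_pairs_perturbedP XE XtE XsE lama lamas dA.
  by split=> [[dAS P1 P2 P3]|[dAS /JP[P1 P2 P3]]]; split=> //; apply/JP.
have rT : r = total_size dp ds by rewrite rE (total_sizeE XE XsE).
(* The cofactor of the characteristic polynomial carrying the remaining eigenvalues; its kernel at
   [A] complements the chains. *)
pose p2 := \prod_(k < n - r) ('X - (lamf k)%:P).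
have p2c x : ~~ root p2 (group_eig S lamc lamcs x).
  rewrite rootE horner_prod prodf_seq_neq0; apply/allP => k _ /=.
  rewrite hornerXsubC subr_eq0; apply: contra (lamfN k) => /eqP <-.
  exact: mem_eig_list.
have XcOrth l p0 (Z : 'M_(n, l)) :
    (forall x, ~~ root p0 (group_eig S lamc lamcs x)) ->
    (Z^T <= kermxpoly A^T p0)%MS -> Xc^t* *m H *m Z = 0.
  exact: (chain_orth XE XtE XsE lamcs_self unitH AS).
have uG : Xc^t* *m H *m Xc \in unitmx.
  apply: (gram_unitmx unitH fX (M := kermxpoly A^T p2)).
    by apply: (XcOrth _ _ _ p2c); rewrite trmxK.
  exact: (chain_span_rest XE XtE XsE eig_uniq pE p2c).
have dAX : dA *m Xc = Xc *m (La - Lc) := gram_perturbation_mulmx _ uG.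
(* [dA] factors through a space of dimension [r]. *)
have rank_dA : (\rank dA <= r)%N.
  rewrite rT /dA -!mulmxA; apply: leq_trans (mxrankM_maxl _ _) _.
  exact: rank_leq_col.
split=> //.
- split.
  + exact: (gram_perturbation_in_class unitH eps1E adjH GD uG).
  + exact/(perturbed_mulmxP dA La (chain_eigen XE XtE XsE)).
  (* A remaining chain is killed by a power of [A - lamf t], coprime to the factors of the chosen
     eigenvalues; hence it is [H]-orthogonal to [Xc], and [dA Y = 0]. *)
  + move=> t d Y JY; have Y0 : Xc^t* *m H *m Y = 0.
      apply: XcOrth (jordan_pair_sub_kermxpoly JY) => x.
      rewrite rootE horner_exp hornerXsubC expf_eq0 subr_eq0 negb_and.
      apply/orP; right; apply: contra (lamfN t) => /eqP <-.
      exact: mem_eig_list.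
    case: JY => _ _ _ AY; rewrite mulmxDl AY /dA -!mulmxA (mulmxA _ H Y) Y0.
    by rewrite !mulmx0 addr0.
(* If every chosen eigenvalue really changes, [La - Lc] is invertible, and so is the product
   [Xc^t* H dA Xc = G (La - Lc)], where [G] is the Gram matrix; this bounds the rank of [dA] below
   by [r]. *)
- move=> al als; apply/eqP; rewrite eqn_leq rank_dA /=.
  have uD : La - Lc \in unitmx := jordan_mxB_unit XE XtE XsE al als.
  have : (\rank (Xc^t* *m H *m (dA *m Xc)) <= \rank dA)%N.
    by apply: leq_trans (mxrankM_maxr _ _) (mxrankM_maxl _ _).
  rewrite dAX mulmxA mxrank_unit; first by rewrite -rT.
  by rewrite unitmx_mul uG uD.
Qed.
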